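(* Let $K\in\mathcal L(\mathcal H)$ and let $\mathcal W=\{(W_i,w_i)\}_{i\in I}$ be a $K$-fusion frame for $\mathcal H$. Let $T\in\mathcal L(\mathcal H)$ have closed range, with $TK=KT$ and $T^{\dagger}T(W_i)\subset W_i$ for all $i\in I$, where $T^\dagger$ is the pseudo-inverse of $T$. If $T$ is surjective, then $\{(TW_i,w_i)\}_{i\in I}$ is a $K$-fusion frame for $\mathcal H$.
   Context: $\mathcal H$ is a separable Hilbert space, $\mathcal L(\mathcal H)$ is the space of bounded linear operators on $\mathcal H$, and $I$ is a countable index set. For a closed subspace $W$, $\pi_W$ denotes the orthogonal projection onto $W$; $R(\cdot)$ and $N(\cdot)$ denote range and kernel. Let $\{W_i\}_{i\in I}$ be a sequence of closed subspaces of $\mathcal H$, $\{w_i\}_{i\in I}$ a family of weights ($w_i>0$ for all $i$), and $K\in\mathcal L(\mathcal H)$. Then $\{(W_i,w_i)\}_{i\in I}$ is a $K$-fusion frame for $\mathcal H$ if there exist constants $0<A\le B<\infty$ such that $A\|K^*f\|^2\le\sum_{i\in I}w_i^2\|\pi_{W_i}(f)\|^2\le B\|f\|^2$ for all $f\in\mathcal H$ (in particular the subspaces are required to be closed). For $T\in\mathcal L(\mathcal H)$ with closed range, the pseudo-inverse $T^\dagger\in\mathcal L(\mathcal H)$ is the unique bounded operator with $N(T^\dagger)=R(T)^\perp$, $R(T^\dagger)=N(T)^\perp$ and $TT^\dagger y=y$ for all $y\in R(T)$. *)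

(* Defs.v *)
From HB Require Import structures.
From mathcomp Require Import all_boot all_order all_algebra.
From mathcomp Require Import all_classical all_reals all_analysis.
From mathcomp.real_closed Require Import complex.

Set Implicit Arguments.
Unset Strict Implicit.
Unset Printing Implicit Defensive.

Import Order.TTheory GRing.Theory Num.Theory.
Import numFieldNormedType.Exports.

Local Open Scope classical_set_scope.
Local Open Scope ring_scope.

(* Hilbert spaces may be real or complex: [scalar R k] is [R] or [R[i]]. *)
Variant scalar_kind := RealScalars | ComplexScalars.

Definition scalar (R : realType) (k : scalar_kind) : numFieldType :=
  match k with
  | RealScalars => R
  | ComplexScalars => R[i]
  end.

Definition scalar_conj (R : realType) (k : scalar_kind) :
    scalar R k -> scalar R k :=
  match k return scalar R k -> scalar R k with
  | RealScalars => fun a => a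
  | ComplexScalars => @conjc R
  end.

Definition scalar_re (R : realType) (k : scalar_kind) : scalar R k -> R :=
  match k return scalar R k -> R with
  | RealScalars => fun a => a
  | ComplexScalars => @complex.Re R
  end.

(* The inner product is linear in its first argument and conjugate-linear in
   the second. *)
HB.mixin Record isHilbert (R : realType) (k : scalar_kind) H
    of CompleteNormedModule (scalar R k) H := {
  inner : {dot H for @scalar_conj R k} ;
  sqr_normE : forall x : H, `|x| ^+ 2 = inner x x
}.

#[short(type="hilbertType")]
HB.structure Definition Hilbert (R : realType) (k : scalar_kind) :=
  {H of isHilbert R k H & CompleteNormedModule (scalar R k) H}.

Notation "''[' x , y ]" := (inner x y) : ring_scope.

Definition separable_space (H : topologicalType) : Prop :=
  exists2 D : set H, countable D & dense D.

Section HilbertNotions.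
Context (R : realType) (k : scalar_kind) (H : hilbertType R k).
Implicit Types (A W : set H) (T S : {linear H -> H}).

(* The norm of a normed module over [R[i]] takes its values in [R[i]], hence
   the real part. *)
Definition hnorm (x : H) : R := scalar_re `|x|.

Definition bounded_operator T : Prop :=
  exists M : R, forall x, hnorm (T x) <= M * hnorm x.

Definition ker T : set H := [set x | T x = 0].

Definition orthogonal_complement A : set H :=
  [set x | forall y, A y -> '[x, y] = 0].

Definition closed_subspace W : Prop :=
  [/\ closed W, W 0 & forall (a : scalar R k) x y, W x -> W y -> W (a *: x + y)].

(* For a closed subspace [W], the point selected below exists and is unique;
   for other sets the value has no meaning. *)
Definition proj W (f : H) : H :=
  xget 0 [set p | W p /\ orthogonal_complement W (f - p)].

(* For a bounded [T], the point selected below exists and is unique (Riesz). *)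
Definition adjoint T (f : H) : H :=
  xget 0 [set g | forall x, '[T x, f] = '[x, g]].

Definition is_pseudo_inverse T S : Prop :=
  [/\ bounded_operator S,
      ker S = orthogonal_complement (range T),
      range S = orthogonal_complement (ker T) &
      forall y, range T y -> T (S y) = y].

Definition K_fusion_frame (K : {linear H -> H}) (I : countType)
    (W : I -> set H) (w : I -> R) : Prop :=
  [/\ forall i, closed_subspace (W i),
      forall i, 0 < w i &
      exists A B : R, [/\ 0 < A, A <= B & forall f : H,
        ((A * hnorm (adjoint K f) ^+ 2)%:E
           <= \esum_(i in [set: I]) (w i ^+ 2 * hnorm (proj (W i) f) ^+ 2)%:E)%E
        /\
        (\esum_(i in [set: I]) (w i ^+ 2 * hnorm (proj (W i) f) ^+ 2)%:E
           <= (B * hnorm f ^+ 2)%:E)%E]].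

End HilbertNotions.

(* Main.v *)
Require Import Defs.
From HB Require Import structures.
From mathcomp Require Import all_boot all_order all_algebra.
From mathcomp Require Import all_classical all_reals all_analysis.
From mathcomp.real_closed Require Import complex.
From mathcomp Require Import ring lra.

Set Implicit Arguments.
Unset Strict Implicit.
Unset Printing Implicit Defensive.

Import Order.TTheory GRing.Theory Num.Theory.
Import numFieldNormedType.Exports.

Local Open Scope classical_set_scope.
Local Open Scope ring_scope.

(** Write S for the pseudo-inverse of T. Surjectivity of T gives TS = 1, and the
    invariance of W_i under ST gives T W_i = S^-1(W_i); so T W_i is a closed
    subspace, since S is bounded.

    The two fusion frame sums are compared through the adjoint T*. On one hand,
    T maps W_i into T W_i, which gives
      |pi_{W_i} T* f| <= |T| |pi_{T W_i} f|     ([hnorm_proj_adjoint_le]).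
    On the other hand, S maps T W_i into W_i and TS = 1, which gives
      |pi_{T W_i} f| <= |S| |pi_{W_i} T* f|     ([hnorm_proj_le_adjoint]).
    Hence the frame inequalities of (W_i, w_i) at T* f give those of
    (T W_i, w_i) at f: the upper one because |T* f| <= |T| |f|, the lower one
    because K* T* = T* K* and |g| <= |S| |T* g| for every g
    ([hnorm_le_adjoint]).

    All this needs orthogonal projections and adjoints to exist. The projection
    theorem [projection_exists] comes from the completeness of H and the
    parallelogram law; Riesz's theorem [riesz], hence [adjoint_inner], follows.
    The real and complex cases are treated together through the real part
    [re_inner] of the inner product, a real inner product with the same norm;
    orthogonality over the scalars is recovered by [inner_eq0P]. *)

(** * Inequalities between real numbers and between sums *)

Lemma ler_sqr_mul (R : realType) (a b : R) :
  0 <= a -> 0 <= b -> a ^+ 2 <= a * b -> a <= b.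
Proof.
rewrite le_eqVlt => /predU1P[<-//|a0] _.
by rewrite expr2 ler_pM2l.
Qed.

Lemma esum_le_scale (R : realType) (I : choiceType) (a b : I -> R) (c : R) :
  0 <= c -> (forall i, b i <= c * a i) ->
  (\esum_(i in [set: I]) (b i)%:E <= c%:E * \esum_(i in [set: I]) (a i)%:E)%E.
Proof.
move=> c0 bca; apply: ub_ereal_sup => _ [F FI <-].
apply: (@le_trans _ _ (c%:E * \sum_(i \in F) (a i)%:E)%E); last first.
  by rewrite lee_wpmul2l ?lee_fin//; apply: ereal_sup_ubound; exists F.
have Ffin : finite_set F by case: FI.
rewrite !fsbig_finite//= !sumEFin -EFinM lee_fin mulr_sumr.
by apply: ler_sum => i _; exact: bca.
Qed.

(** * Real and complex scalars *)

Section ScalarTheory.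
Context (R : realType) (k : scalar_kind).
Implicit Types (a b : Defs.scalar R k) (r : R).

(** The real number [r] seen as a scalar. *)
Definition real_scalar (r : R) : Defs.scalar R k :=
  match k return Defs.scalar R k with
  | RealScalars => r
  | ComplexScalars => r%:C%C
  end.

Lemma scalar_re0 : scalar_re (0 : Defs.scalar R k) = 0.
Proof. by rewrite /scalar_re; case: k. Qed.

Lemma scalar_reD a b : scalar_re (a + b) = scalar_re a + scalar_re b.
Proof. by move: a b; rewrite /scalar_re; case: k => //= [[? ?] [? ?]]. Qed.

Lemma scalar_reN a : scalar_re (- a) = - scalar_re a.
Proof. by move: a; rewrite /scalar_re; case: k => //= [[? ?]]. Qed.

Lemma scalar_re_conj a : scalar_re (scalar_conj a) = scalar_re a.
Proof. by move: a; rewrite /scalar_re /scalar_conj; case: k => //= [[? ?]]. Qed.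

Lemma scalar_re_real r a : scalar_re (real_scalar r * a) = r * scalar_re a.
Proof.
move: a; rewrite /scalar_re /real_scalar; case: k => //= [[? ?]] /=.
by rewrite mul0r subr0.
Qed.

Lemma scalar_conj0 : scalar_conj (0 : Defs.scalar R k) = 0.
Proof.
by rewrite /scalar_conj; case: k => //=; rewrite /conjc /= oppr0.
Qed.

Lemma scalar_conjK : involutive (@scalar_conj R k).
Proof.
by move=> a; move: a; rewrite /scalar_conj; case: k => //= a; rewrite conjcK.
Qed.

Lemma real_scalar_re a : 0 <= a -> a = real_scalar (scalar_re a).
Proof.
move: a; rewrite /real_scalar /scalar_re; case: k => //= [[x y]].
by rewrite lecE /= => /andP[/eqP ->].
Qed.

Lemma real_scalar_lt r1 r2 : (real_scalar r1 < real_scalar r2) = (r1 < r2).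
Proof. by rewrite /real_scalar; case: k => //=; rewrite ltcR. Qed.

Lemma real_scalar_le r1 r2 : (real_scalar r1 <= real_scalar r2) = (r1 <= r2).
Proof. by rewrite /real_scalar; case: k => //=; rewrite lecR. Qed.

Lemma real_scalar0 : real_scalar 0 = 0.
Proof. by rewrite /real_scalar; case: k. Qed.

Lemma real_scalarD r1 r2 :
  real_scalar (r1 + r2) = real_scalar r1 + real_scalar r2.
Proof. by rewrite /real_scalar; case: k => //=; rewrite rmorphD. Qed.

Lemma real_scalarX r n : real_scalar (r ^+ n) = real_scalar r ^+ n.
Proof. by rewrite /real_scalar; case: k => //=; rewrite rmorphXn. Qed.

Lemma real_scalarK r : scalar_re (real_scalar r) = r.
Proof. by rewrite /scalar_re /real_scalar; case: k. Qed.

Lemma scalar_re_sqr_eq0 a : scalar_re (scalar_conj a * a) = 0 -> a = 0.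
Proof.
move: a; rewrite /scalar_re /scalar_conj; case: k => /= [a|[x y]] /=.
  by move/eqP; rewrite mulf_eq0 orbb => /eqP.
move=> h; have : x ^+ 2 + y ^+ 2 = 0 by rewrite -[RHS]h; ring.
move/eqP; rewrite paddr_eq0 ?sqr_ge0 // !sqrf_eq0 => /andP[/eqP -> /eqP ->].
by [].
Qed.

End ScalarTheory.

(** * The real inner product and the norm *)

Section HilbertTheory.
Context (R : realType) (k : scalar_kind) (H : hilbertType R k).
Implicit Types (x y z f g : H) (W : set H) (a : Defs.scalar R k) (r : R).

(** The real part of the inner product: a real inner product on [H] with the
    same norm. *)
Definition re_inner x y : R := scalar_re '[x, y].

Lemma norm_hnorm x : `|x| = real_scalar k (hnorm x).
Proof. exact/real_scalar_re. Qed.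

Lemma hnorm_ge0 x : 0 <= hnorm x.
Proof. by rewrite -(real_scalar_le k) real_scalar0 -norm_hnorm. Qed.

Lemma hnorm_eq0 x : hnorm x = 0 -> x = 0.
Proof. by move=> h; apply/normr0_eq0; rewrite norm_hnorm h real_scalar0. Qed.

Lemma hnormD x y : hnorm (x + y) <= hnorm x + hnorm y.
Proof.
by rewrite -(real_scalar_le k) real_scalarD -!norm_hnorm ler_normD.
Qed.

Lemma sqr_hnormE x : hnorm x ^+ 2 = re_inner x x.
Proof.
by rewrite /re_inner -sqr_normE norm_hnorm -real_scalarX real_scalarK.
Qed.

Lemma innerC x y : '[x, y] = scalar_conj '[y, x].
Proof.
have := @hermitian_subproof _ _ _ _ (inner (s := H)) x y.
by rewrite expr0 mul1r.
Qed.

Lemma innerC_eq0 x y : '[x, y] = 0 -> '[y, x] = 0.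
Proof. by rewrite (innerC y x) => ->; rewrite scalar_conj0. Qed.

Lemma re_innerC x y : re_inner x y = re_inner y x.
Proof. by rewrite /re_inner innerC scalar_re_conj. Qed.

Lemma re_innerDl x y z : re_inner (x + y) z = re_inner x z + re_inner y z.
Proof. by rewrite /re_inner linearDl scalar_reD. Qed.

Lemma re_innerNl x z : re_inner (- x) z = - re_inner x z.
Proof. by rewrite /re_inner linearNl scalar_reN. Qed.

Lemma re_innerZl r x z : re_inner (real_scalar k r *: x) z = r * re_inner x z.
Proof. by rewrite /re_inner linearZl_LR scalar_re_real. Qed.

Lemma re_innerDr x y z : re_inner z (x + y) = re_inner z x + re_inner z y.
Proof. by rewrite re_innerC re_innerDl !(re_innerC z). Qed.

Lemma re_innerNr x z : re_inner z (- x) = - re_inner z x.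
Proof. by rewrite re_innerC re_innerNl (re_innerC z). Qed.

Lemma re_innerZr r x z : re_inner z (real_scalar k r *: x) = r * re_inner z x.
Proof. by rewrite re_innerC re_innerZl (re_innerC z). Qed.

(** Orthogonality over the scalars amounts to real orthogonality to the whole
    line spanned by [y]; the choice [a = '[x, y]] gives the converse. *)
Lemma inner_eq0P x y :
  '[x, y] = 0 <-> forall a, re_inner x (a *: y) = 0.
Proof.
rewrite /re_inner; split=> [h a|/(_ '[x, y])].
  by rewrite linearZr_LR /= h mulr0 scalar_re0.
by rewrite linearZr_LR /=; apply: scalar_re_sqr_eq0.
Qed.

Lemma sqr_hnormB x y :
  hnorm (x - y) ^+ 2 = hnorm x ^+ 2 - 2 * re_inner x y + hnorm y ^+ 2.
Proof.
rewrite !sqr_hnormE !(re_innerDl, re_innerDr, re_innerNl, re_innerNr).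
by rewrite (re_innerC y x); ring.
Qed.

(** Cauchy-Schwarz inequality. *)
Lemma re_inner_le x y : re_inner x y <= hnorm x * hnorm y.
Proof.
have hx := hnorm_ge0 x; have hy := hnorm_ge0 y.
have [y0|y0] := eqVneq (hnorm y) 0.
  have -> : y = 0 by exact: hnorm_eq0.
  by rewrite /re_inner linear0r scalar_re0 mulr_ge0 ?hnorm_ge0.
have ygt0 : 0 < hnorm y by rewrite lt_neqAle eq_sym y0.
have [x0|x0] := eqVneq (hnorm x) 0.
  have -> : x = 0 by exact: hnorm_eq0.
  by rewrite /re_inner linear0l scalar_re0 mulr_ge0 ?hnorm_ge0.
have xgt0 : 0 < hnorm x by rewrite lt_neqAle eq_sym x0.
(* expand the squared norm of |y| x - |x| y *)
have := sqr_ge0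
  (hnorm (real_scalar k (hnorm y) *: x - real_scalar k (hnorm x) *: y)).
rewrite sqr_hnormB !sqr_hnormE !(re_innerZl, re_innerZr) -!sqr_hnormE => h.
rewrite -subr_ge0 -(pmulr_rge0 _ (mulr_gt0 xgt0 ygt0)); nra.
Qed.

(** * Closed sets and Cauchy sequences in terms of the real-valued norm *)

Lemma closed_hnormP W : closed W <->
  forall x, (forall e, 0 < e -> exists2 y, W y & hnorm (x - y) < e) -> W x.
Proof.
split=> [Wcl x h|h x xW].
  apply: Wcl => B.
  move=> /nbhs_ballP[e /= e0 eB].
  have e0' : 0 < scalar_re e.
    by rewrite -(real_scalar_lt k) real_scalar0 -real_scalar_re// ltW.
  have [y Wy xy] := h _ e0'; exists y; split=> //; apply: eB.
  by rewrite -ball_normE /= norm_hnorm (real_scalar_re (ltW e0)) real_scalar_lt.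
apply: h => e e0.
have e0' : 0 < real_scalar k e by rewrite -(real_scalar0 R k) real_scalar_lt.
have [y [Wy]] := xW _ (nbhsx_ballx x _ e0').
rewrite -ball_normE /= norm_hnorm real_scalar_lt => xy.
by exists y.
Qed.

Lemma hnorm_complete (u : nat -> H) :
  (forall e, 0 < e ->
     exists N, forall n m, (N <= n)%N -> (N <= m)%N -> hnorm (u n - u m) < e) ->
  exists l, forall e, 0 < e ->
    exists N, forall n, (N <= n)%N -> hnorm (u n - l) < e.
Proof.
move=> uC.
have : cvg (u n @[n --> \oo]).
  apply/cauchy_cvgP/cauchy_exP => e e0.
  have e0' : 0 < scalar_re e.
    by rewrite -(real_scalar_lt k) real_scalar0 -real_scalar_re// ltW.
  have [N hN] := uC _ e0'; exists (u N); exists N => // n /= Nn.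
  rewrite -ball_normE /= norm_hnorm (real_scalar_re (ltW e0)) real_scalar_lt.
  exact: hN.
move=> /cvg_ballP ul; exists (lim (u n @[n --> \oo])) => e e0.
have e0' : 0 < real_scalar k e by rewrite -(real_scalar0 R k) real_scalar_lt.
have [N _ hN] := ul _ e0'; exists N => n Nn.
have := hN n Nn; rewrite -ball_normE /= distrC norm_hnorm real_scalar_lt.
exact.
Qed.

(** * The projection theorem *)

(** Variational characterization: a point of the subspace [W] that is at
    minimal distance from [f] is the foot of a perpendicular. *)
Lemma orthogonal_minimizer W f p : closed_subspace W -> W p ->
  (forall q, W q -> hnorm (f - p) ^+ 2 <= hnorm (f - q) ^+ 2) ->
  orthogonal_complement W (f - p).
Proof.
move=> [_ W0 Wlin] Wp pmin y Wy.
apply/inner_eq0P => a.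
have Way : W (a *: y) by rewrite -[_ *: _]addr0; exact: Wlin.
(* it remains to prove real orthogonality to every vector of W *)
move: (a *: y) Way => {a y Wy} y Wy.
have key t : 0 <= t ^+ 2 * hnorm y ^+ 2 - 2 * (t * re_inner (f - p) y).
  have := pmin _ (Wlin (real_scalar k t) _ _ Wy Wp).
  rewrite [_ + p]addrC opprD addrA (sqr_hnormB (f - p)) re_innerZr.
  rewrite (sqr_hnormE (_ *: _)) re_innerZl re_innerZr -sqr_hnormE.
  by move=> h; nra.
set b := re_inner _ _ in key *; set c := hnorm y ^+ 2 in key.
(* The value t = b / c minimizes the quadratic c t^2 - 2 b t; c may be zero,
   and c + 1 in its place still gives a negative value unless b = 0. *)
have c1 : 0 < c + 1 by rewrite ltr_wpDl ?sqr_ge0.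
have := key (b / (c + 1)).
have -> : (b / (c + 1)) ^+ 2 * c - 2 * (b / (c + 1) * b) =
  - (b ^+ 2 * (c + 2) / (c + 1) ^+ 2) by field; rewrite gt_eqF.
rewrite oppr_ge0 pmulr_lle0 ?invr_gt0 ?exprn_gt0// pmulr_lle0; last by lra.
by move=> h; apply/eqP; rewrite -sqrf_eq0 eq_le h sqr_ge0.
Qed.

Lemma parallelogram x y :
  hnorm (x + y) ^+ 2 + hnorm (x - y) ^+ 2 = 2 * (hnorm x ^+ 2 + hnorm y ^+ 2).
Proof.
rewrite !sqr_hnormE !(re_innerDl, re_innerDr, re_innerNl, re_innerNr); ring.
Qed.

Lemma hnormZ_real r x : 0 <= r -> hnorm (real_scalar k r *: x) = r * hnorm x.
Proof.
move=> r0; apply/eqP.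
rewrite -(@eqrXn2 _ 2)// ?hnorm_ge0 ?mulr_ge0 ?hnorm_ge0//.
by rewrite exprMn !sqr_hnormE re_innerZl re_innerZr mulrA expr2.
Qed.

(** A minimizing sequence for the distance from [f] to [W] is Cauchy by the
    parallelogram law; its limit is orthogonal by [orthogonal_minimizer]. *)
Theorem projection_exists W f : closed_subspace W ->
  exists p, W p /\ orthogonal_complement W (f - p).
Proof.
move=> Wsub; have [Wcl W0 Wlin] := Wsub.
pose D : set R := [set hnorm (f - q) ^+ 2 | q in W].
have Dinf : has_inf D.
  split; first by exists (hnorm (f - 0) ^+ 2); exists 0.
  by exists 0 => _ [q _ <-]; exact: sqr_ge0.
have Dle q : W q -> inf D <= hnorm (f - q) ^+ 2.
  by move=> Wq; apply: ge_inf; [case: Dinf|exists q].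
have /choice[u uP] : forall n, exists q,
    W q /\ hnorm (f - q) ^+ 2 < inf D + n.+1%:R^-1.
  move=> n; have /inf_adherent : (0 : R) < n.+1%:R^-1 by rewrite invr_gt0.
  by move=> /(_ _ Dinf)[_ [q Wq <-] h]; exists q.
have Wmid x y : W x -> W y -> W (real_scalar k 2^-1 *: (x + y)).
  move=> Wx Wy; rewrite scalerDr; apply: (Wlin) => //.
  by rewrite -[_ *: _]addr0; apply: (Wlin).
have udist n m : hnorm (u n - u m) ^+ 2 <= 2 * (n.+1%:R^-1 + m.+1%:R^-1).
  have [Wn dn] := uP n; have [Wm dm] := uP m.
  (* the midpoint of u n and u m belongs to W, so its squared distance to f
     is at least inf D *)
  have := Dle _ (Wmid _ _ Wn Wm).
  have -> : f - real_scalar k 2^-1 *: (u n + u m) =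
      real_scalar k 2^-1 *: ((f - u n) + (f - u m)).
    rewrite addrACA -opprD scalerBr; congr (_ - _).
    rewrite -mulr2n -scalerMnr scalerMnl mulr2n -real_scalarD.
    have -> : 2^-1 + 2^-1 = 1 :> R by field.
    have -> : real_scalar k (1 : R) = 1 by rewrite /real_scalar; case: (k).
    by rewrite scale1r.
  rewrite hnormZ_real ?invr_ge0// exprMn.
  have := parallelogram (f - u n) (f - u m).
  have -> : (f - u n) - (f - u m) = - (u n - u m).
    by rewrite !opprB addrC addrA subrK.
  rewrite (sqr_hnormE (- _)) re_innerNl re_innerNr opprK -sqr_hnormE.
  have -> : (2^-1 : R) ^+ 2 = 4^-1 by rewrite expr2; field.
  move: dn dm; move: (inf D) (n.+1%:R^-1) (m.+1%:R^-1) (hnorm _ ^+ 2).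
  move=> a b c A; move: (hnorm _ ^+ 2) (hnorm _ ^+ 2) (hnorm _ ^+ 2).
  by move=> B C E; lra.
have inv_small (e : R) : 0 < e ->
    exists N, forall n, (N <= n)%N -> n.+1%:R^-1 < e.
  move=> e0; have [N _ hN] := near_infty_natSinv_lt (PosNum e0).
  by exists N => n Nn; exact: hN.
have [p up] : exists p, forall e, 0 < e ->
    exists N, forall n, (N <= n)%N -> hnorm (u n - p) < e.
  apply: hnorm_complete => e e0.
  have e4 : 0 < e ^+ 2 / 4 by rewrite divr_gt0 ?exprn_gt0.
  have [N hN] := inv_small _ e4; exists N => n m /hN nN /hN mN.
  rewrite -(@ltr_pXn2r _ 2)// ?nnegrE ?hnorm_ge0 ?ltW//.
  apply: le_lt_trans (udist n m) _.
  by move: (n.+1%:R^-1) (m.+1%:R^-1) nN mN => b c; lra.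
have Wp : W p.
  move/closed_hnormP: Wcl; apply => e e0.
  have [N hN] := up _ e0; exists (u N); first by case: (uP N).
  have := hN _ (leqnn N).
  suff -> : hnorm (p - u N) = hnorm (u N - p) by [].
  by rewrite /hnorm distrC.
exists p; split=> //; apply: orthogonal_minimizer => // q Wq.
apply: le_trans (Dle q Wq).
have D0 : 0 <= inf D.
  by apply: lb_le_inf; [case: Dinf|move=> _ [z _ <-]; exact: sqr_ge0].
apply/ler_addgt0Pr => e e0.
set d := hnorm (f - p); have d0 : 0 <= d := hnorm_ge0 _.
(* e' is chosen so that d <= |f - u n| + e' and |f - u n|^2 < inf D + e'
   give d ^+ 2 <= inf D + e' * (1 + 2 * d). *)
pose e' := e / (1 + 2 * d).
have e'0 : 0 < e' by rewrite divr_gt0// ltr_wpDr// mulr_ge0.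
have e'E : e' * (1 + 2 * d) = e.
  by rewrite /e' divfK// gt_eqF// ltr_wpDr// mulr_ge0.
have [N1 h1] := up _ e'0; have [N2 h2] := inv_small _ e'0.
have := h1 _ (leq_maxl N1 N2); have := h2 _ (leq_maxr N1 N2).
set n := maxn N1 N2 => nsmall unp.
have [_ dn] := uP n.
have : d <= hnorm (f - u n) + hnorm (u n - p).
  by rewrite /d -[f - p](subrKA (u n)) hnormD.
have := hnorm_ge0 (f - u n); rewrite -e'E.
move: (hnorm (f - u n)) dn => t dn t0 dt.
move: (inf D) D0 (n.+1%:R^-1) nsmall dn => m m0 c ce' dn.
have [de|ed] := leP d e'.
  have : 0 <= d * (e' - d) by rewrite mulr_ge0// subr_ge0.
  have : 0 <= d * e' by rewrite mulr_ge0// ltW.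
  lra.
have : (d - e') ^+ 2 <= t ^+ 2 by rewrite lerXn2r ?nnegrE//; lra.
by have := sqr_ge0 e'; lra.
Qed.

(** * Orthogonal complements and Riesz representation *)

Lemma projP W f : closed_subspace W ->
  W (Defs.proj W f) /\ orthogonal_complement W (f - Defs.proj W f).
Proof. by move=> Wsub; exact: xgetPex (projection_exists f Wsub). Qed.

Lemma orthogonal_re_inner W x y :
  orthogonal_complement W x -> W y -> re_inner x y = 0.
Proof. by move=> xW Wy; rewrite /re_inner xW// scalar_re0. Qed.

Lemma orthogonal_complement_closed (A : set H) :
  closed (orthogonal_complement A).
Proof.
apply/closed_hnormP => x xA z Az; apply/inner_eq0P.
have le0 a : re_inner x (a *: z) <= 0.
  apply/ler_addgt0Pr => e e0; rewrite add0r.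
  set c := hnorm (a *: z) + 1.
  have c0 : 0 < c by rewrite ltr_wpDl ?hnorm_ge0.
  have [y Ay xy] := xA _ (divr_gt0 e0 c0).
  have yaz : re_inner y (a *: z) = 0.
    by move: a {c c0 xy}; apply/inner_eq0P; exact: Ay.
  have -> : re_inner x (a *: z) = re_inner (x - y) (a *: z).
    by rewrite re_innerDl re_innerNl yaz oppr0 addr0.
  apply: le_trans (re_inner_le _ _) _.
  rewrite -[leRHS](divfK (lt0r_neq0 c0)).
  by rewrite ler_pM ?hnorm_ge0// ?(ltW xy)// lerDl.
move=> a; apply/eqP; rewrite eq_le le0 /= -oppr_le0 -re_innerNr -scaleNr.
exact: le0.
Qed.

(** A linear form with closed kernel is represented by a suitable multiple of a
    vector [z] orthogonal to the kernel: [phi z *: x - phi x *: z] lies in the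
    kernel for every [x]. *)
Theorem riesz (phi : H -> Defs.scalar R k) :
  (forall a x y, phi (a *: x + y) = a * phi x + phi y) ->
  closed [set x | phi x = 0] -> exists g, forall x, phi x = '[x, g].
Proof.
move=> phi_lin ker_closed.
have phi0 : phi 0 = 0.
  have := phi_lin 1 0 0; rewrite scaler0 addr0 mul1r => /eqP.
  by rewrite -subr_eq0 opprD addNKr oppr_eq0 => /eqP.
have kersub : closed_subspace [set x | phi x = 0].
  by split=> //= a x y px py; rewrite phi_lin px py mulr0 addr0.
have [phi_eq0|/existsNP[x0 phi_x0]] := pselect (forall x, phi x = 0).
  by exists 0 => x; rewrite phi_eq0 linear0r.
have [p [pN z_orth]] := projection_exists x0 kersub.
set z := x0 - p in z_orth.
have phiB x y : phi (x - y) = phi x - phi y.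
  by rewrite addrC -scaleN1r phi_lin mulN1r addrC.
have phi_z : phi z <> 0 by rewrite /z phiB pN subr0.
have zz : '[z, z] != 0.
  rewrite -sqr_normE sqrf_eq0 normr_eq0; apply/eqP => z0.
  by apply: phi_z; rewrite z0.
exists (scalar_conj (phi z / '[z, z]) *: z) => x.
rewrite linearZr_LR /= scalar_conjK.
have /z_orth : phi (phi z *: x - phi x *: z) = 0.
  rewrite phiB -[_ *: x]addr0 -[_ *: z]addr0 !phi_lin phi0 !addr0.
  by rewrite mulrC subrr.
move=> /innerC_eq0; rewrite linearBl !linearZl_LR /= => /eqP.
rewrite subr_eq0 => /eqP e.
suff : phi x = phi z * ('[z, z]^-1 * '[x, z]) by exact.
by rewrite mulrA mulrAC e mulfK.
Qed.

(** * Bounded operators and their adjoints *)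

Implicit Types T S : {linear H -> H}.

Lemma bounded_operator_ge1 T : bounded_operator T ->
  exists2 t : R, 1 <= t & forall x, hnorm (T x) <= t * hnorm x.
Proof.
move=> [M TM]; exists (Num.max 1 M); first by rewrite le_max lexx.
move=> x; apply: le_trans (TM x) _.
by rewrite ler_wpM2r ?hnorm_ge0// le_max lexx orbT.
Qed.

Lemma closed_preimage T W : bounded_operator T -> closed W ->
  closed [set x | W (T x)].
Proof.
move=> /bounded_operator_ge1[t t1 Tt] /closed_hnormP Wcl.
have t0 : 0 < t by exact: lt_le_trans t1.
apply/closed_hnormP => x xW; apply: Wcl => e e0.
have [y Wy xy] := xW _ (divr_gt0 e0 t0); exists (T y) => //.
rewrite -linearB; apply: le_lt_trans (Tt _) _.
by rewrite mulrC -ltr_pdivlMr.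
Qed.

Lemma adjoint_inner T x f : bounded_operator T -> '[T x, f] = '[x, adjoint T f].
Proof.
move=> Tb; rewrite /adjoint.
have : exists g, forall x, '[T x, f] = '[x, g].
  apply: riesz => [a y z|]; first by rewrite linearP linearPl.
  have -> : [set y | '[T y, f] = 0] =
      [set y | orthogonal_complement [set f] (T y)].
    by apply/seteqP; split=> y /= yf; [by move=> _ ->|exact: yf].
  by apply: closed_preimage => //; exact: orthogonal_complement_closed.
by move=> /(xgetPex 0); exact.
Qed.

Lemma re_inner_adjoint T x f : bounded_operator T ->
  re_inner (T x) f = re_inner x (adjoint T f).
Proof. by move=> Tb; rewrite /re_inner adjoint_inner. Qed.

Lemma adjoint_commute T S f : bounded_operator T -> bounded_operator S ->
  (forall x, T (S x) = S (T x)) ->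
  adjoint T (adjoint S f) = adjoint S (adjoint T f).
Proof.
move=> Tb Sb TS; apply/eqP; rewrite -subr_eq0; apply/eqP.
set d := _ - _; apply: hnorm_eq0; apply/eqP; rewrite -sqrf_eq0 sqr_hnormE.
rewrite {2}/d re_innerDr re_innerNr -!re_inner_adjoint//.
by rewrite TS subrr.
Qed.

Lemma hnorm_adjoint_le T (t : R) f : bounded_operator T -> 0 <= t ->
  (forall x, hnorm (T x) <= t * hnorm x) -> hnorm (adjoint T f) <= t * hnorm f.
Proof.
move=> Tb t0 Tt; apply: ler_sqr_mul; rewrite ?mulr_ge0 ?hnorm_ge0//.
rewrite sqr_hnormE -re_inner_adjoint//; apply: le_trans (re_inner_le _ _) _.
by rewrite mulrA ler_wpM2r ?hnorm_ge0// mulrC.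
Qed.

(** The adjoint of an operator with a bounded right inverse is bounded below. *)
Lemma hnorm_le_adjoint T S (s : R) f : bounded_operator T -> 0 <= s ->
  (forall x, hnorm (S x) <= s * hnorm x) -> cancel S T ->
  hnorm f <= s * hnorm (adjoint T f).
Proof.
move=> Tb s0 Ss ST; apply: ler_sqr_mul; rewrite ?mulr_ge0 ?hnorm_ge0//.
rewrite sqr_hnormE -{1}[f]ST re_inner_adjoint//.
apply: le_trans (re_inner_le _ _) _.
by rewrite mulrA ler_wpM2r ?hnorm_ge0// mulrC.
Qed.

(** * Projections onto subspaces exchanged by an operator *)

Lemma re_inner_proj W x f : closed_subspace W -> W x ->
  re_inner x (Defs.proj W f) = re_inner x f.
Proof.
move=> Wsub Wx; have [_ /orthogonal_re_inner/(_ Wx)] := projP f Wsub.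
by rewrite re_innerC re_innerDr re_innerNr => /eqP; rewrite subr_eq0 => /eqP ->.
Qed.

(** For [u := proj W (adjoint T f)], the squared norm of [u] is the inner
    product of [T u] and [f], and [f] may be replaced there by its projection
    onto [V], as [T u] lies in [V]. *)
Lemma hnorm_proj_adjoint_le T (t : R) W V f : bounded_operator T -> 0 <= t ->
  (forall x, hnorm (T x) <= t * hnorm x) ->
  closed_subspace W -> closed_subspace V -> (forall x, W x -> V (T x)) ->
  hnorm (Defs.proj W (adjoint T f)) <= t * hnorm (Defs.proj V f).
Proof.
move=> Tb t0 Tt Wsub Vsub WV; have [Wp _] := projP (adjoint T f) Wsub.
apply: ler_sqr_mul; rewrite ?mulr_ge0 ?hnorm_ge0//.
rewrite sqr_hnormE re_inner_proj// -re_inner_adjoint//.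
rewrite -(re_inner_proj _ Vsub (WV _ Wp)); apply: le_trans (re_inner_le _ _) _.
by rewrite mulrA ler_wpM2r ?hnorm_ge0// mulrC.
Qed.

(** For [p := proj V f], write [p] as [T (S p)]: its squared norm is the inner
    product of [S p] and [adjoint T f], and the latter may be replaced by its
    projection onto [W], as [S p] lies in [W]. *)
Lemma hnorm_proj_le_adjoint T S (s : R) W V f : bounded_operator T -> 0 <= s ->
  (forall x, hnorm (S x) <= s * hnorm x) -> cancel S T ->
  closed_subspace W -> closed_subspace V -> (forall y, V y -> W (S y)) ->
  hnorm (Defs.proj V f) <= s * hnorm (Defs.proj W (adjoint T f)).
Proof.
move=> Tb s0 Ss ST Wsub Vsub VW; have [Vp _] := projP f Vsub.
apply: ler_sqr_mul; rewrite ?mulr_ge0 ?hnorm_ge0//.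
rewrite sqr_hnormE re_inner_proj// -{1}[Defs.proj V f]ST re_inner_adjoint//.
rewrite -(re_inner_proj _ Wsub (VW _ Vp)); apply: le_trans (re_inner_le _ _) _.
by rewrite mulrA ler_wpM2r ?hnorm_ge0// mulrC.
Qed.

End HilbertTheory.

(** * Images of a fusion frame *)

Theorem theorem5 (R : realType) (k : scalar_kind) (H : hilbertType R k)
  (H_separable : separable_space H)
  (I : countType) (W : I -> set H) (w : I -> R)
  (K : {linear H -> H}) (K_bounded : bounded_operator K)
  (W_frame : K_fusion_frame K W w)
  (T : {linear H -> H}) (T_bounded : bounded_operator T)
  (T_closed_range : closed (range T))
  (TK_commute : forall x, T (K x) = K (T x))
  (Tdag : {linear H -> H}) (Tdag_pinv : is_pseudo_inverse T Tdag)
  (TdagT_invariant : forall i, (Tdag \o T) @` W i `<=` W i)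
  (T_surjective : range T = [set: H]) :
  K_fusion_frame K (fun i => T @` W i) w.
Proof.
have [Tdag_bounded _ _ TTdag] := Tdag_pinv.
have TdagK : cancel Tdag T by move=> y; apply: TTdag; rewrite T_surjective.
have [Wsub w0 [A [B [A0 AB frame]]]] := W_frame.
have TdagW i y : (T @` W i) y -> W i (Tdag y).
  by move=> [x Wx <-]; apply: TdagT_invariant; exists x.
(* T W_i is closed, being the preimage of W_i under the pseudo-inverse *)
have TWE i : T @` W i = [set y | W i (Tdag y)].
  apply/seteqP; split=> y; first exact: TdagW.
  by move=> /= Wy; exists (Tdag y) => //; exact: TdagK.
have TWsub i : closed_subspace (T @` W i).
  rewrite TWE; have [Wcl W0 Wlin] := Wsub i.
  split; [exact: closed_preimage|by rewrite /= linear0|].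
  by move=> a x y /= Wx Wy; rewrite linearP; exact: Wlin.
(* bounds at least 1, so that A / (s t)^2 <= A <= B <= B (s t)^2 *)
have [t t1 Tt] := bounded_operator_ge1 T_bounded.
have [s s1 Ss] := bounded_operator_ge1 Tdag_bounded.
have t0 : 0 < t by exact: lt_le_trans t1.
have s0 : 0 < s by exact: lt_le_trans s1.
have st1 : 1 <= (s * t) ^+ 2 by rewrite exprn_ege1// mulr_ege1.
have st0 : 0 < (s * t) ^+ 2 by exact: lt_le_trans st1.
have TW i x : W i x -> (T @` W i) (T x) by move=> Wx; exists x.
have B0 : 0 <= B by exact: le_trans (ltW A0) AB.
split=> //; exists (A / (s * t) ^+ 2), (B * (s * t) ^+ 2); split.
- by rewrite divr_gt0.
- apply: (@le_trans _ _ A).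
    by rewrite ler_pdivrMr// ler_peMr// ltW.
  by apply: le_trans AB _; rewrite ler_peMr.
move=> f; have [lower upper] := frame (adjoint T f).
have sqrM (x y c : R) : 0 <= x -> x <= c * y -> x ^+ 2 <= c ^+ 2 * y ^+ 2.
  by move=> x0 xy; rewrite -exprMn lerXn2r// nnegrE (le_trans x0).
split.
- have Kf : hnorm (adjoint K f) ^+ 2 <=
      s ^+ 2 * hnorm (adjoint K (adjoint T f)) ^+ 2.
    rewrite -(adjoint_commute f T_bounded K_bounded TK_commute).
    apply: sqrM; first exact: hnorm_ge0.
    exact: hnorm_le_adjoint (ltW s0) Ss TdagK.
  have sumle : (\esum_(i in [set: I])
        (w i ^+ 2 * hnorm (Defs.proj (W i) (adjoint T f)) ^+ 2)%:E <=
      (t ^+ 2)%:E * \esum_(i in [set: I])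
        (w i ^+ 2 * hnorm (Defs.proj (T @` W i) f) ^+ 2)%:E)%E.
    apply: esum_le_scale => [|i]; first exact: sqr_ge0.
    rewrite [leRHS]mulrCA ler_wpM2l ?sqr_ge0//.
    apply: sqrM; first exact: hnorm_ge0.
    exact: hnorm_proj_adjoint_le (ltW t0) Tt (Wsub i) (TWsub i) (TW i).
  have tt0 : 0 < t ^+ 2 by rewrite exprn_gt0.
  rewrite -(@lee_pmul2l _ (t ^+ 2)%:E)//.
  apply: le_trans sumle; apply: le_trans lower.
  rewrite -EFinM lee_fin exprMn.
  have -> : t ^+ 2 * (A / (s ^+ 2 * t ^+ 2) * hnorm (adjoint K f) ^+ 2) =
      A * (hnorm (adjoint K f) ^+ 2 / s ^+ 2).
    by field; rewrite !gt_eqF.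
  by rewrite ler_wpM2l ?(ltW A0)// ler_pdivrMr ?exprn_gt0// mulrC.
- apply: (@le_trans _ _ ((s ^+ 2)%:E * \esum_(i in [set: I])
      (w i ^+ 2 * hnorm (Defs.proj (W i) (adjoint T f)) ^+ 2)%:E)%E).
    apply: esum_le_scale => [|i]; first exact: sqr_ge0.
    rewrite [leRHS]mulrCA ler_wpM2l ?sqr_ge0//.
    apply: sqrM; first exact: hnorm_ge0.
    exact: hnorm_proj_le_adjoint (ltW s0) Ss TdagK (Wsub i) (TWsub i)
      (@TdagW i).
  apply: le_trans (lee_wpmul2l _ upper) _; first by rewrite lee_fin sqr_ge0.
  rewrite -EFinM lee_fin exprMn.
  have := sqrM _ _ _ (hnorm_ge0 _) (hnorm_adjoint_le f T_bounded (ltW t0) Tt).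
  move=> /(ler_wpM2l (mulr_ge0 (sqr_ge0 s) B0)).
  by lra.
Qed.
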